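(* Let $\sigma\colon\mathrm{Sym}^{++}(3)\to\mathrm{Sym}(3)$, $V\mapsto\sigma(V)$, be an isotropic tensor function (the Cauchy stress response) which is injective and continuously differentiable. Assume moreover that $$\langle \mathrm{sym}\,\mathrm{D}\sigma(\mathbb{1}).H,\,H\rangle>0\qquad\text{for all } H\in\mathrm{Sym}(3)\setminus\{0\},$$ where $\mathbb{1}$ is the identity matrix. Then the strong Baker-Ericksen inequalities are satisfied everywhere, i.e. for all $\lambda=(\lambda_1,\lambda_2,\lambda_3)$ with positive entries and all $i,j\in\{1,2,3\}$, $$\lambda_i>\lambda_j\quad\Longrightarrow\quad \widehat\sigma_i(\lambda)>\widehat\sigma_j(\lambda),$$ where $\widehat\sigma$ is the representation of $\sigma$ in terms of principal stretches.
   Context: $\mathrm{Sym}(3)$ denotes the real symmetric $3\times3$ matrices with inner product $\langle A,B\rangle=\mathrm{tr}(A^TB)$, and $\mathrm{Sym}^{++}(3)$ the open subset of positive definite ones; $\mathrm{O}(3)$ is the orthogonal group. $\sigma$ is isotropic if $\sigma(Q^TVQ)=Q^T\sigma(V)Q$ for all $Q\in\mathrm{O}(3)$ and $V\in\mathrm{Sym}^{++}(3)$. In this case there is a unique function $\widehat\sigma=(\widehat\sigma_1,\widehat\sigma_2,\widehat\sigma_3)\colon(0,\infty)^3\to\mathbb{R}^3$ with $$\sigma\big(Q^T\mathrm{diag}(\lambda_1,\lambda_2,\lambda_3)Q\big)=Q^T\mathrm{diag}(\widehat\sigma(\lambda_1,\lambda_2,\lambda_3))Q\qquad\text{for all }Q\in\mathrm{O}(3),\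 \lambda\in(0,\infty)^3.$$ It satisfies $\widehat\sigma_i(\lambda_{\pi(1)},\lambda_{\pi(2)},\lambda_{\pi(3)})=\widehat\sigma_{\pi(i)}(\lambda)$ for all permutations $\pi$. The eigenvalues $\lambda_i$ of $V$ are the principal stretches and $\sigma_i=\widehat\sigma_i(\lambda)$ the corresponding principal stresses. $\mathrm{D}\sigma(\mathbb{1})\colon\mathrm{Sym}(3)\to\mathrm{Sym}(3)$ is the Fréchet derivative at the identity, $\mathrm{D}\sigma(\mathbb{1}).H$ its application to $H$, and $\mathrm{sym}\,\mathrm{D}\sigma(\mathbb{1})$ its symmetric (self-adjoint) part with respect to $\langle\cdot,\cdot\rangle$. *)

(* Defs.v *)
From HB Require Import structures.
From mathcomp Require Import all_boot all_order all_algebra sesquilinear.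
From mathcomp Require Import all_classical all_reals all_analysis.
From mathcomp Require Import ring lra.

Set Implicit Arguments.
Unset Strict Implicit.
Unset Printing Implicit Defensive.

Import Order.TTheory GRing.Theory Num.Theory.
Import numFieldNormedType.Exports.

Local Open Scope classical_set_scope.
Local Open Scope ring_scope.

Section SymmetricMatrices.
Variables (R : realType) (n : nat).
Implicit Types A B : 'M[R]_n.

Definition symmx : {pred 'M[R]_n} := fun A => A \is symmetricmx.

Lemma symmxP A : reflect (A^T = A) (A \in symmx).
Proof.
have -> : (A \in symmx) = (A^T == A).
  by rewrite [LHS]is_hermitianmxE expr0 scale1r map_mx_id// eq_sym.
exact: eqP.
Qed.

Lemma symmx_submod_closed : submod_closed symmx.
Proof.
split; first by apply/symmxP; rewrite trmx0.
move=> a A B /symmxP sA /symmxP sB; apply/symmxP.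
by rewrite linearD linearZ /= sA sB.
Qed.

HB.instance Definition _ := GRing.isSubmodClosed.Build R 'M[R]_n symmx
  symmx_submod_closed.

Record Sym : predArgType := MkSym { symval :> 'M[R]_n ; _ : symval \in symmx }.

HB.instance Definition _ := [isSub for symval].
HB.instance Definition _ := [Choice of Sym by <:].
HB.instance Definition _ := [SubChoice_isSubLmodule of Sym by <:].

(* The norm on Sym is the restriction of the library norm of 'M[R]_n (largest
   absolute value of an entry).  In finite dimension it defines the same
   derivatives and the same continuity as the norm of the inner product below. *)
Let norm (S : Sym) : R := `|val S|.

Let sym_ler_normD (S T : Sym) : norm (S + T) <= norm S + norm T.
Proof. exact: ler_normD. Qed.

Let sym_normrZ (a : R) (S : Sym) : norm (a *: S) = `|a| * norm S.
Proof. exact: normrZ. Qed.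

Let sym_normr0_eq0 (S : Sym) : norm S = 0 -> S = 0.
Proof. by move=> /normr0_eq0 S0; exact: val_inj. Qed.

HB.instance Definition _ :=
  Lmodule_isNormed.Build R Sym sym_ler_normD sym_normrZ sym_normr0_eq0.

Definition posdef : set Sym :=
  [set V | forall x : 'cV[R]_n, x != 0 -> 0 < (x^T *m val V *m x) 0 0].

Definition orthogonalmx : set 'M[R]_n := [set Q | Q^T *m Q = 1%:M].

Lemma conj_symmx (Q : 'M[R]_n) (S : Sym) : Q^T *m val S *m Q \in symmx.
Proof.
by apply/symmxP; rewrite !trmx_mul trmxK (symmxP _ (valP S)) mulmxA.
Qed.

Definition conjS (Q : 'M[R]_n) (S : Sym) : Sym := MkSym (conj_symmx Q S).

Lemma diag_symmx (d : 'rV[R]_n) : diag_mx d \in symmx.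
Proof. by apply/symmxP; rewrite tr_diag_mx. Qed.

Definition diagS (d : 'rV[R]_n) : Sym := MkSym (diag_symmx d).

Lemma id_symmx : 1%:M \in symmx.
Proof. by apply/symmxP; rewrite trmx1. Qed.

Definition idS : Sym := MkSym id_symmx.

Definition inner (S T : Sym) : R := \tr ((val S)^T *m val T).

Implicit Types S T U V : Sym.

Lemma innerE S T : inner S T = \sum_i \sum_j val S i j * val T i j.
Proof.
rewrite /inner /mxtrace exchange_big; apply: eq_bigr => j _.
by rewrite mxE; apply: eq_bigr => i _; rewrite mxE.
Qed.

Lemma innerC S T : inner S T = inner T S.
Proof. by rewrite -[LHS]mxtrace_tr trmx_mul trmxK. Qed.

Let inner_linearl T : linear (inner^~ T : Sym -> R^o).
Proof.
by move=> a S S'; rewrite /inner !linearD !linearZ /= mulmxDl -scalemxAl !linearD linearZ.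
Qed.

Lemma inner_eq0 S : inner S S = 0 -> S = 0.
Proof.
rewrite innerE => /eqP.
rewrite psumr_eq0 => [|i _]; last by apply: sumr_ge0 => j _; exact: sqr_ge0.
move=> /allP S0; apply/val_inj/matrixP => i j; rewrite mxE.
have := S0 i (mem_index_enum i); rewrite psumr_eq0 => [|k _]; last exact: sqr_ge0.
by move=> /allP/(_ j (mem_index_enum j)); rewrite mulf_eq0 orbb => /eqP.
Qed.

Definition is_adjoint (L M : Sym -> Sym) :=
  forall S T, inner (L S) T = inner S (M T).

Definition adjoint (L : {linear Sym -> Sym}) : {linear Sym -> Sym} :=
  get (fun M : {linear Sym -> Sym} => is_adjoint L M).

Lemma elem_symmx (i j : 'I_n) :
  2^-1 *: (delta_mx i j + delta_mx j i) \in symmx.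
Proof.
by apply/symmxP; rewrite linearZ linearD /= !trmx_delta addrC.
Qed.

Let elemS i j : Sym := MkSym (elem_symmx i j).

Let Sym_sum_elem S : S = \sum_i \sum_j val S i j *: elemS i j.
Proof.
have val_sum (F : 'I_n -> Sym) : val (\sum_i F i) = \sum_i val (F i).
  exact: (big_morph val).
apply: val_inj; rewrite val_sum; under eq_bigr do rewrite val_sum.
rewrite [LHS](_ : _ = 2^-1 *: (val S + (val S)^T)); last first.
  rewrite (symmxP _ (valP S)) -mulr2n -[X in _ *: X]scaler_nat.
  by rewrite scalerA mulVf ?scale1r ?pnatr_eq0.
rewrite [X in X + X^T]matrix_sum_delta !linear_sum -big_split scaler_sumr /=.
apply: eq_bigr => i _; rewrite linear_sum -big_split scaler_sumr /=.
apply: eq_bigr => j _; rewrite linearZ /= trmx_delta -scalerDr.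
by rewrite !scalerA mulrC.
Qed.

Lemma adjointP (L : {linear Sym -> Sym}) : is_adjoint L (adjoint L).
Proof.
have adj_symmx T : \matrix_(i, j) inner (L (elemS i j)) T \in symmx.
  apply/symmxP/matrixP => i j; rewrite !mxE; congr (inner (L _) T).
  by apply: val_inj; rewrite /= addrC.
pose M0 T : Sym := MkSym (adj_symmx T).
have M0_linear : linear M0.
  move=> a T T'; apply/val_inj/matrixP => i j; rewrite !mxE.
  by rewrite !(innerC (L _)) inner_linearl.
pose M0l := GRing.isLinear.Build R Sym Sym _ M0 M0_linear.
pose M : {linear Sym -> Sym} := HB.pack M0 M0l.
apply: (@getPex _ (fun M : {linear Sym -> Sym} => is_adjoint L M)).
exists M => S T.
pose iTl := GRing.isLinear.Build R Sym R^o _ (inner^~ T) (inner_linearl T).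
pose iT : {linear Sym -> R^o} := HB.pack (inner^~ T : Sym -> R^o) iTl.
rewrite [RHS]innerE {1}(Sym_sum_elem S).
rewrite linear_sum -[LHS]/(iT _) linear_sum; apply: eq_bigr => i _.
rewrite linear_sum linear_sum; apply: eq_bigr => j _.
by rewrite linearZ linearZ /= mxE.
Qed.

Lemma is_adjoint_uniq (L M M' : Sym -> Sym) :
  is_adjoint L M -> is_adjoint L M' -> M =1 M'.
Proof.
move=> LM LM' T; apply/eqP; rewrite -subr_eq0; apply/eqP/inner_eq0.
have innerBr S U V : inner S (U - V : Sym) = inner S U - inner S V.
  by rewrite /inner !linearB.
by rewrite innerBr -LM -LM' subrr.
Qed.

Definition sym_part (L : {linear Sym -> Sym}) (S : Sym) : Sym :=
  2^-1 *: (L S + adjoint L S).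

End SymmetricMatrices.

Section TensorFunctions.
Variables (R : realType) (n : nat).

(* A function on the positive definite matrices is encoded by a total function
   on Sym R n, of which only the values on posdef matter; since posdef is open,
   this also goes for its differentials at points of posdef. *)
Implicit Type sigma : Sym R n -> Sym R n.

Definition isotropic sigma :=
  forall (Q : 'M[R]_n) (V : Sym R n), orthogonalmx Q -> posdef V ->
    sigma (conjS Q V) = conjS Q (sigma V).

Definition principal_representation sigma (hsigma : 'rV[R]_n -> 'rV[R]_n) :=
  forall (Q : 'M[R]_n) (l : 'rV[R]_n), orthogonalmx Q -> (forall i, 0 < l 0 i) ->
    sigma (conjS Q (diagS l)) = conjS Q (diagS (hsigma l)).

Lemma posdef_diagS (l : 'rV[R]_n) :
  (forall i, 0 < l 0 i) -> posdef (diagS l).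
Proof.
move=> l0 x x0; rewrite -mulmxA mxE.
have sq i : x^T 0 i * (diag_mx l *m x) i 0 = l 0 i * x i 0 ^+ 2.
  by rewrite mul_diag_mx !mxE expr2; ring.
have [i xi0] : exists i, x i 0 != 0.
  apply/existsP; apply: contra_neqT x0 => /existsPn x0.
  by apply/colP => i; rewrite mxE; apply/eqP/negPn/x0.
rewrite (bigD1 i) //= sq; apply: ltr_pwDl.
  by rewrite mulr_gt0// lt0r sqrf_eq0 xi0 sqr_ge0.
by apply: sumr_ge0 => k _; rewrite sq mulr_ge0 ?sqr_ge0// ltW.
Qed.

Lemma principal_representation_ex sigma : isotropic sigma ->
  exists hsigma, principal_representation sigma hsigma.
Proof.
move=> iso; exists (fun l => \row_i val (sigma (diagS l)) i i) => Q l OQ l0.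
rewrite iso//; last exact: posdef_diagS.
congr conjS; apply/val_inj/matrixP => i j; rewrite !mxE.
have [->|ij] := eqVneq i j; first by rewrite mulr1n.
rewrite mulr0n.
pose s : 'rV[R]_n := \row_k (-1) ^+ (k == i).
have sE (A : 'M[R]_n) k m :
    ((diag_mx s)^T *m A *m diag_mx s) k m = s 0 k * s 0 m * A k m.
  by rewrite tr_diag_mx mul_mx_diag mul_diag_mx !mxE; ring.
have ss k : s 0 k * s 0 k = 1 by rewrite mxE -expr2 sqrr_sign.
have Os : orthogonalmx (diag_mx s).
  rewrite /orthogonalmx /= -[_^T]mulmx1; apply/matrixP => k m.
  rewrite sE !mxE; have [->|_] := eqVneq k m; last by rewrite mulr0.
  by have := ss m; rewrite mxE => ->; rewrite mulr1.
have Dfix : conjS (diag_mx s) (diagS l) = diagS l.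
  apply/val_inj/matrixP => k m; rewrite [LHS]sE /= [diag_mx l k m]mxE.
  by have [->|_] := eqVneq k m; rewrite ?mulr0n ?mulr0// ss mul1r.
have := congr1 (fun S : Sym R n => val S i j)
  (iso _ _ Os (posdef_diagS l0)).
rewrite Dfix [RHS]sE !mxE eqxx eq_sym (negPf ij) expr1 expr0 => sij.
by apply/eqP; rewrite -eqNr; apply/eqP; rewrite [RHS]sij; ring.
Qed.

Lemma principal_representation_uniq sigma hsigma hsigma' :
    principal_representation sigma hsigma ->
    principal_representation sigma hsigma' ->
  forall l : 'rV[R]_n, (forall i, 0 < l 0 i) -> hsigma l = hsigma' l.
Proof.
move=> r r' l l0; have O1 : orthogonalmx (1%:M : 'M[R]_n).
  by rewrite /orthogonalmx /= trmx1 mulmx1.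
have := r _ _ O1 l0; rewrite (r' _ _ O1 l0) => /(congr1 val) /=.
rewrite trmx1 !mul1mx !mulmx1 => e; apply/rowP => i.
by have := congr1 (fun A : 'M[R]_n => A i i) e; rewrite !mxE eqxx !mulr1n.
Qed.

End TensorFunctions.

(* The second clause is the continuity of y |-> 'd f y on U for the operator
   norm. *)
Definition continuously_differentiable (R : realType) (V W : normedModType R)
    (U : set V) (f : V -> W) :=
  (forall x, U x -> differentiable f x) /\
  (forall x, U x -> forall e : R, 0 < e ->
    \forall y \near x, U y -> forall h, `|'d f y h - 'd f x h| <= e * `|h|).

(* Main.v *)
From mathcomp Require Import all_boot fingroup perm.
Require Import Defs.
From HB Require Import structures.
From mathcomp Require Import all_boot all_order all_algebra.
From mathcomp Require Import all_classical all_reals all_analysis.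
From mathcomp Require Import ring lra.

Set Implicit Arguments.
Unset Strict Implicit.
Unset Printing Implicit Defensive.

Import Order.TTheory GRing.Theory Num.Theory.
Import numFieldNormedType.Exports.

Local Open Scope classical_set_scope.
Local Open Scope ring_scope.

(** The gap between two principal stresses can change sign only where the two
stretches coincide.  Let [l i > l j].  If [hsigma l i = hsigma l j], then
exchanging the stretches [l i] and [l j] leaves the principal stresses fixed,
by isotropy, so that [sigma] takes the same value at two distinct diagonal
matrices, against injectivity ([principal_stress_neq]).  Hence the continuous
function [hsigma p i - hsigma p j] has no zero on the convex set of the
positive [p] with [p i > p j], and by the intermediate value theorem along
segments its sign there is constant ([inner_segment_gt0]).

It remains to see that it is positive somewhere.  Put
[H := diag (e_i - e_j)], so that the gap at [p] is
[inner (sigma (diag p)) H].  It vanishes at the identity, where all principal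
stresses agree by isotropy ([principal_stress_const]), and its derivative there
along [H] is [inner ('d sigma 1 H) H], which is positive by hypothesis, since a
linear map and its symmetric part have the same quadratic form
([inner_sym_part]).  So the gap is positive at [1 + t *: H] for small [t > 0]
([increment_inner_gt0]). *)

Lemma diagSD (R : realType) n (c d : 'rV[R]_n) :
  diagS (c + d) = diagS c + diagS d.
Proof. by apply: val_inj; rewrite /= linearD. Qed.

Lemma diagSZ (R : realType) n a (d : 'rV[R]_n) : diagS (a *: d) = a *: diagS d.
Proof. by apply: val_inj; rewrite /= linearZ. Qed.

Lemma diagS_inj (R : realType) n : injective (@diagS R n).
Proof.
move=> c d /(congr1 val) /= cd; apply/rowP => k.
by have := congr1 (fun A : 'M[R]_n => A k k) cd; rewrite !mxE eqxx.
Qed.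

Lemma idSE (R : realType) n : idS R n = diagS (const_mx 1).
Proof. by apply: val_inj; rewrite /= diag_const_mx. Qed.

Lemma inner_diagS (R : realType) n (c d : 'rV[R]_n) :
  inner (diagS c) (diagS d) = \sum_k c 0 k * d 0 k.
Proof.
rewrite innerE; apply: eq_bigr => k _; rewrite (bigD1 k)//= big1 ?addr0.
  by rewrite !mxE eqxx.
by move=> m mk; rewrite !mxE eq_sym (negPf mk) mul0r.
Qed.

Lemma inner_linear (R : realType) n (T : Sym R n) :
  linear ((fun S => inner S T) : Sym R n -> R^o).
Proof.
move=> a S S'.
by rewrite /inner !linearD !linearZ /= mulmxDl -scalemxAl !linearD linearZ.
Qed.

(** The norm of [Sym] is that of the ambient matrix space, so the inclusion is
    an isometry. *)
Lemma symval_continuous (R : realType) n :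
  continuous (@symval R n : Sym R n -> 'M[R]_n).
Proof.
move=> S; apply/(@cvgrPdist_lt _ _ _ (nbhs S)) => e e0.
exact: (@cvgr_dist_lt R (Sym R n) (Sym R n) (nbhs S) _ id S cvg_id e e0).
Qed.

Lemma inner_continuous (R : realType) n (T : Sym R n) :
  continuous ((fun S => inner S T) : Sym R n -> R).
Proof.
have -> : (fun S => inner S T) =
    (fun S : Sym R n => \sum_i \sum_j val S i j * val T i j).
  by apply/funext => S; rewrite innerE.
apply: continuous_big => [|i _]; first exact: add_continuous.
apply: continuous_big => [|j _]; first exact: add_continuous.
move=> S; apply: (@cvgMr_tmp _ _ (nbhs S)).
apply: (@continuous_comp _ _ _ (@symval R n) (fun M : 'M[R]_n => M i j)).
  exact: symval_continuous.
exact: coord_continuous.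
Qed.

Lemma innerDl (R : realType) n (S S' T : Sym R n) :
  inner (S + S') T = inner S T + inner S' T.
Proof. by rewrite -[S]scale1r inner_linear !scale1r. Qed.

Lemma innerZl (R : realType) n a (S T : Sym R n) :
  inner (a *: S) T = a * inner S T.
Proof. by apply: (addIr (inner 0 T)); rewrite -innerDl inner_linear. Qed.

(** The skew part of a linear map does not contribute to its quadratic form:
    [inner (adjoint L S) S = inner S (L S)]. *)
Lemma inner_sym_part (R : realType) n (L : {linear Sym R n -> Sym R n})
  (S : Sym R n) : inner (sym_part L S) S = inner (L S) S.
Proof.
by rewrite innerZl innerDl [inner (adjoint L S) S]innerC -adjointP; lra.
Qed.

Lemma perm_mx_orthogonal (R : realType) n (s : 'S_n) :
  @orthogonalmx R n (perm_mx s).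
Proof. by rewrite /orthogonalmx /= tr_perm_mx -perm_mxM mulVg perm_mx1. Qed.

(** Isotropy acts on the principal stretches through permutation matrices.  The
    inverse appears because [conjS Q] has the transpose of [Q] on the left. *)
Lemma conjS_perm_diagS (R : realType) n (s : 'S_n) (d : 'rV[R]_n) :
  conjS (perm_mx s^-1) (diagS d) = diagS (col_perm s d).
Proof.
apply/val_inj/matrixP => k m.
rewrite /= tr_perm_mx invgK -row_permE -col_permE !mxE.
by rewrite (inj_eq perm_inj).
Qed.

Lemma principal_diagS (R : realType) n (sigma : Sym R n -> Sym R n) hsigma
    (l : 'rV[R]_n) : principal_representation sigma hsigma ->
  (forall k, 0 < l 0 k) -> sigma (diagS l) = diagS (hsigma l).
Proof.
move=> rep l0; have := rep _ _ (@perm_mx_orthogonal R n 1^-1) l0.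
by rewrite !conjS_perm_diagS !col_perm1.
Qed.

Lemma principal_perm (R : realType) n (sigma : Sym R n -> Sym R n) hsigma
    (s : 'S_n) (l : 'rV[R]_n) : principal_representation sigma hsigma ->
  (forall k, 0 < l 0 k) -> hsigma (col_perm s l) = col_perm s (hsigma l).
Proof.
move=> rep l0; apply: diagS_inj; rewrite -(principal_diagS rep); last first.
  by move=> k; rewrite mxE.
by rewrite -!conjS_perm_diagS; apply: rep => //; exact: perm_mx_orthogonal.
Qed.

(** A spherical stretch is fixed by every transposition, hence so is its
    stress. *)
Lemma principal_stress_const (R : realType) n (sigma : Sym R n -> Sym R n)
    hsigma a i j : principal_representation sigma hsigma -> 0 < a ->
  hsigma (const_mx a : 'rV[R]_n) 0 i = hsigma (const_mx a) 0 j.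
Proof.
move=> rep a0.
have := @principal_perm _ _ _ _ (tperm i j) (const_mx a) rep.
rewrite (_ : col_perm _ _ = const_mx a); last by apply/rowP => k; rewrite !mxE.
move=> /(_ _)/rowP/(_ i) ->; first by rewrite mxE tpermL.
by move=> k; rewrite mxE.
Qed.

(** Equal principal stresses would not notice the exchange of the stretches
    [l 0 i] and [l 0 j], although it changes the matrix. *)
Lemma principal_stress_neq (R : realType) n (sigma : Sym R n -> Sym R n)
    hsigma (l : 'rV[R]_n) i j : principal_representation sigma hsigma ->
  {in @posdef R n &, injective sigma} -> (forall k, 0 < l 0 k) ->
  l 0 i != l 0 j -> hsigma l 0 i != hsigma l 0 j.
Proof.
move=> rep inj l0; apply: contra_neq => sij.
have tl0 k : 0 < col_perm (tperm i j) l 0 k by rewrite mxE.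
have : diagS (col_perm (tperm i j) l) = diagS l.
  apply: inj; rewrite ?inE; [exact: posdef_diagS..|].
  rewrite !(principal_diagS rep)// (principal_perm _ rep)//.
  congr diagS; apply/rowP => k; rewrite mxE.
  by case: tpermP => // ->.
by move=> /diagS_inj/rowP/(_ j); rewrite mxE tpermR.
Qed.

(** The difference quotient of [sigma] along [H], paired with [H], tends to
    the quadratic form of the differential at [H], so it is eventually
    positive. *)
Lemma increment_inner_gt0 (R : realType) n (sigma : Sym R n -> Sym R n)
    (V H : Sym R n) : differentiable sigma V ->
  0 < inner (sym_part ('d sigma V) H) H ->
  \forall t \near 0^'+, inner (sigma V) H < inner (sigma (V + t *: H)) H.
Proof.
move=> dsigma; rewrite inner_sym_part -deriveE// => dH.
have quot : t^-1 *: (sigma (t *: H + V) - sigma V) @[t --> 0^'+]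
    --> 'D_H sigma V.
  by apply: cvg_dnbhs_at_right; exact: diff_derivable.
have quotH := cvg_comp _ _ quot (@inner_continuous _ _ H _).
near=> t.
have t0 : 0 < t by near: t; exact: nbhs_right_gt.
have : 0 < inner (t^-1 *: (sigma (t *: H + V) - sigma V)) H.
  by near: t; exact: cvgr_gt quotH _ dH.
rewrite innerZl innerDl -scaleN1r innerZl mulN1r pmulr_rgt0 ?invr_gt0//.
by rewrite subr_gt0 addrC.
Unshelve. all: by end_near. Qed.

Lemma inner_segment_continuous (R : realType) n (sigma : Sym R n -> Sym R n)
    (T A B : Sym R n) s :
  {for A + s *: B, continuous sigma} ->
  {for s, continuous (fun s : R => inner (sigma (A + s *: B)) T : R)}.
Proof.
move=> c.
have cp : {for s, continuous (fun s : R => A + s *: B)}.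
  apply: cvgD; first exact: cvg_cst.
  by apply: cvgZr_tmp; exact: cvg_id.
exact: (continuous_comp (continuous_comp cp c) (@inner_continuous _ _ T _)).
Qed.

Lemma segment_gt0 (R : realFieldType) (a b s : R) :
  0 < a -> 0 < b -> 0 <= s <= 1 -> 0 < a + s * (b - a).
Proof.
move=> a0 b0 /andP[s0 s1].
have -> : a + s * (b - a) = (1 - s) * a + s * b by ring.
have [->|sn0] := eqVneq s 0; first by rewrite subr0 mul1r mul0r addr0.
apply: ltr_wpDl; last by rewrite mulr_gt0// lt0r sn0.
by rewrite mulr_ge0 ?subr_ge0// ltW.
Qed.

Lemma inner_segment_gt0 (R : realType) n (sigma : Sym R n -> Sym R n)
    (T A B : Sym R n) :
  (forall s, 0 <= s <= 1 -> {for A + s *: B, continuous sigma}) ->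
  (forall s, 0 <= s <= 1 -> inner (sigma (A + s *: B)) T != 0) ->
  0 < inner (sigma A) T -> 0 < inner (sigma (A + B)) T.
Proof.
move=> sigmac neq0 A0; rewrite ltNge; apply/negP => B0.
pose g (s : R) := inner (sigma (A + s *: B)) T.
(* A change of sign would force a zero of [g] in [0, 1]. *)
have [||s s01 /eqP] := @IVT R g 0 1 0 ler01.
- apply: continuous_in_subspaceT => s; rewrite inE /= in_itv /= => s01.
  exact/inner_segment_continuous/sigmac.
- by rewrite /g scale0r scale1r addr0 ge_min B0 orbT le_max (ltW A0).
- by rewrite in_itv/= in s01; apply/negP/neq0.
Qed.

Theorem theorem4p2 (R : realType) (sigma : Sym R 3 -> Sym R 3)
    (sigma_isotropic : isotropic sigma)
    (sigma_inj : {in @posdef R 3 &, injective sigma})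
    (sigma_C1 : continuously_differentiable (@posdef R 3) sigma)
    (sigma_posdef : forall H : Sym R 3, H != 0 ->
      0 < inner (sym_part ('d sigma (idS R 3)) H) H)
    (hsigma : 'rV[R]_3 -> 'rV[R]_3)
    (hsigma_repr : principal_representation sigma hsigma)
    (l : 'rV[R]_3) (l_gt0 : forall i, 0 < l 0 i) (i j : 'I_3) :
  l 0 i > l 0 j -> hsigma l 0 i > hsigma l 0 j.
Proof.
move=> lij; have ij : i != j by apply: contraTneq lij => ->; rewrite ltxx.
have [sigma_diff _] := sigma_C1.
pose h : 'rV[R]_3 := delta_mx 0 i - delta_mx 0 j.
have h_i : h 0 i = 1 by rewrite !mxE !eqxx (negPf ij) subr0.
have h_j : h 0 j = -1 by rewrite !mxE !eqxx eq_sym (negPf ij) sub0r.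
pose H := diagS h.
have gapE (p : 'rV[R]_3) : (forall k, 0 < p 0 k) ->
    inner (sigma (diagS p)) H = hsigma p 0 i - hsigma p 0 j.
  move=> p0; rewrite (principal_diagS hsigma_repr)// inner_diagS.
  rewrite (bigD1 i)//= (bigD1 j) 1?eq_sym//= big1 ?addr0 => [|k /andP[ki kj]].
    by rewrite h_i h_j mulr1 mulrN1.
  by rewrite !mxE (negPf ki) (negPf kj) subr0 mulr0.
have H0 : H != 0.
  apply/eqP => /(congr1 (fun S : Sym R 3 => val S i i)).
  by rewrite /= [LHS]mxE eqxx h_i mxE => /eqP; rewrite oner_eq0.
have pos1 k : 0 < (const_mx 1 : 'rV[R]_3) 0 k by rewrite mxE.
have := sigma_posdef _ H0; rewrite idSE => posH.
have near1 := increment_inner_gt0 (sigma_diff _ (posdef_diagS pos1)) posH.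
near (0 : R)^'+ => t.
have t0 : 0 < t by near: t; exact: nbhs_right_gt.
(* [t < 1] keeps the entry [1 - t] of [p] positive. *)
have t1 : t < 1 by near: t; exact: nbhs_right_lt.
pose p := const_mx 1 + t *: h.
have p0 k : 0 < p 0 k.
  by rewrite !mxE /=; case: (k == i); case: (k == j) => /=; lra.
have pij : p 0 j < p 0 i by rewrite !mxE in h_i h_j *; rewrite h_i h_j; lra.
have gap_p : 0 < inner (sigma (diagS p)) H.
  rewrite diagSD diagSZ; apply: le_lt_trans (near near1 t _) => //.
  by rewrite gapE// (principal_stress_const i j hsigma_repr)// subrr.
have seg (s : R) : diagS p + s *: diagS (l - p) = diagS (p + s *: (l - p)).
  by rewrite -diagSZ -diagSD.
have segE (s : R) k : (p + s *: (l - p)) 0 k = p 0 k + s * (l 0 k - p 0 k).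
  by rewrite mxE [(s *: (l - p)) 0 k]mxE [(l - p) 0 k]mxE [(- p) 0 k]mxE.
have seg0 (s : R) k : 0 <= s <= 1 -> 0 < (p + s *: (l - p)) 0 k.
  by move=> s01; rewrite segE; exact: segment_gt0.
rewrite -subr_gt0 -gapE//.
have -> : diagS l = diagS p + diagS (l - p) by rewrite -diagSD addrC subrK.
apply: inner_segment_gt0 => // s s01; rewrite seg.
  by apply/differentiable_continuous/sigma_diff/posdef_diagS => k; exact: seg0.
rewrite gapE => [|k]; last exact: seg0.
rewrite subr_eq0; apply: (principal_stress_neq hsigma_repr) => // [k|].
  exact: seg0.
(* Along the segment the gap between the stretches [i] and [j] is interpolated
   between its two positive end values. *)
rewrite gt_eqF// -subr_gt0 !segE.
rewrite (_ : _ - _ =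
    p 0 i - p 0 j + s * ((l 0 i - l 0 j) - (p 0 i - p 0 j))); last by ring.
by apply: segment_gt0; rewrite ?subr_gt0.
Unshelve. all: by end_near. Qed.
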